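(* Let $\alpha,\beta\in L(\partial X)$, $f\in L(X^o)$ and $g\in L(\partial X)$. Decompose $\partial X=A\sqcup B$, where $B=\{x\in\partial X:\beta(x)=0\}$ (possibly empty), and assume that $\alpha(x)\neq 0$ for all $x\in B$. Put $X^o_\beta=X^o\cup A$. Suppose that $|\alpha(x)+\beta(x)|\ge|\beta(x)|$ for all $x\in A$, and that the inequality is strict for some $x\in A$. Then the Robin boundary problem of finding $u\in L(X)$ such that $$\Delta u=f\ \text{ on } X^o,\qquad \alpha(x)\,u(x)+\beta(x)\,\partial_{\vec n}u(x)=g(x)\ \text{ for all } x\in\partial X$$ has a unique solution, given by $u=g/\alpha$ on $B$ and $$u|_{X^o_\beta}=-\widetilde G_{X^o_\beta}\bigl(\tilde f-\widetilde P_{X^o_\beta,B}\,(g/\alpha)|_B\bigr)\quad\text{on } X^o_\beta,$$ where for $x\in X^o_\beta$ and $y\in X$ $$\tilde p(x,y)=\begin{cases}p(x,y)&\text{for } x\in X^o\\ \dfrac{\beta(x)}{\alpha(x)+\beta(x)}\,p(x,y)&\text{for } x\in A\end{cases}\qquad\text{and}\qquad \tilde f(x)=\begin{cases}f(x)&\text{for } x\in X^o\\ \dfrac{-1}{\alpha(x)+\beta(x)}\,g(x)&\text{for } x\in A,\end{cases}$$ $\widetilde P_{X^o_\beta,B}=(\tilde p(x,y))_{x\in X^o_\beta,\,y\in B}$, $\widetilde P_{X^o_\beta}=(\tilde p(x,y))_{x,y\in X^o_\beta}$ and $\widetilde G_{X^o_\beta}=(I_{X^o_\beta}-\widetilde P_{X^o_\beta})^{-1}=\sum_{n\ge0}\widetilde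 P_{X^o_\beta}^{\,n}$. (If $B=\emptyset$, the term with $\widetilde P_{X^o_\beta,B}$ is absent.)
   Context: Let $(X,E)$ be a finite directed graph with $|X|\ge 2$, $E\subset X^2$ without loops, which is strongly connected. Each edge $(x,y)\in E$ carries a weight $a(x,y)>0$, and $a(x,y)=0$ if $(x,y)\notin E$. Put $m(x)=\sum_y a(x,y)$, $p(x,y)=a(x,y)/m(x)$, $P=(p(x,y))_{x,y\in X}$. $L(B)$ is the space of functions $B\to\mathbb{C}$ (column vectors), $Pu(x)=\sum_y p(x,y)u(y)$, and $\Delta=P-I$. The boundary $\partial X$ is an arbitrary non-empty subset of $X$, and $X^o=X\setminus\partial X$. The outer normal derivative is $\partial_{\vec n}u(x)=-\Delta u(x)$ for $x\in\partial X$. *)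

(* Defs.v *)
From HB Require Import structures.
From mathcomp Require Import all_boot all_order all_algebra.
From mathcomp Require Import complex.
From mathcomp Require Import all_classical all_reals all_analysis.
Set Implicit Arguments. Unset Strict Implicit. Unset Printing Implicit Defensive.
Import Order.TTheory GRing.Theory Num.Theory.
Import numFieldNormedType.Exports.
Local Open Scope ring_scope.
Local Open Scope complex_scope.

(* MathComp-Analysis puts the norm topology on R^o for any numFieldType R; it
   has no instance keyed on R[i], which convergence of complex matrices needs. *)
HB.instance Definition _ (R : realType) := NormedModule.copy R[i] R[i]^o.

(* A function on a subset S of X is represented by a function on all of X, of
   which only the values on S are ever used; restr S turns it into the column
   vector indexed by S. *)
Section Restriction.
Variables (R : realType) (X : finType).

Definition restr (S : {set X}) (u : X -> R[i]) : 'cV[R[i]]_#|S| :=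
  \col_(i < #|S|) u (enum_val i).

Definition restr_mx (S T : {set X}) (q : X -> X -> R[i]) :
    'M[R[i]]_(#|S|, #|T|) :=
  \matrix_(i < #|S|, j < #|T|) q (enum_val i) (enum_val j).

End Restriction.

Section Network.
Variables (R : realType) (X : finType).

Definition strongly_connected (E : rel X) : Prop :=
  forall x y : X, connect E x y.

Definition weights_on (E : rel X) (a : X -> X -> R) : Prop :=
  forall x y : X, (E x y -> 0 < a x y) /\ (~~ E x y -> a x y = 0).

Variable a : X -> X -> R.

Definition mass (x : X) : R := \sum_(y : X) a x y.

Definition trans (x y : X) : R := a x y / mass x.

Definition transop (u : X -> R[i]) (x : X) : R[i] :=
  \sum_(y : X) (trans x y)%:C * u y.

Definition laplacian (u : X -> R[i]) (x : X) : R[i] := transop u x - u x.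

Definition normal_deriv (u : X -> R[i]) (x : X) : R[i] := - laplacian u x.

(* D is the boundary of X, so that ~: D is the interior. *)
Variables (D : {set X}) (alpha beta f g : X -> R[i]).

Definition robin_solution (u : X -> R[i]) : Prop :=
  (forall x, x \in ~: D -> laplacian u x = f x) /\
  (forall x, x \in D -> alpha x * u x + beta x * normal_deriv u x = g x).

Definition dirichlet_part : {set X} := [set x in D | beta x == 0].

Definition robin_part : {set X} := D :\: dirichlet_part.

Definition robin_interior : {set X} := ~: D :|: robin_part.

(* trans_robin x y and source_robin x are meaningful for x in robin_interior
   only, where x \in D amounts to x \in robin_part. *)
Definition trans_robin (x y : X) : R[i] :=
  if x \in D then beta x / (alpha x + beta x) * (trans x y)%:C
  else (trans x y)%:C.

Definition source_robin (x : X) : R[i] :=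
  if x \in D then - 1 / (alpha x + beta x) * g x else f x.

Definition trans_robin_mx : 'M[R[i]]_#|robin_interior| :=
  restr_mx robin_interior robin_interior trans_robin.

Definition trans_robin_bd_mx :
    'M[R[i]]_(#|robin_interior|, #|dirichlet_part|) :=
  restr_mx robin_interior dirichlet_part trans_robin.

(* invmx is the inverse on unitmx only: statements using green_robin_mx must
   also assert that 1%:M - trans_robin_mx is invertible. *)
Definition green_robin_mx : 'M[R[i]]_#|robin_interior| :=
  invmx (1%:M - trans_robin_mx).

End Network.

(* Main.v *)
Require Import Defs.
From HB Require Import structures.
From mathcomp Require Import all_boot all_order all_algebra.
From mathcomp Require Import complex.
From mathcomp Require Import all_classical all_reals all_analysis.
From mathcomp Require Import ring.
Set Implicit Arguments. Unset Strict Implicit. Unset Printing Implicit Defensive.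
Import Order.TTheory GRing.Theory Num.Theory.
Import numFieldNormedType.Exports.
Local Open Scope ring_scope.
Local Open Scope complex_scope.
Local Open Scope classical_set_scope.

(** Inserting u = g / alpha on the Dirichlet part B turns the boundary problem
into a linear system on the remaining set S: a harmonic equation in the
interior and, after division by alpha + beta, a Robin condition both read
u - sum_y t(x, y) u(y) = - source(x), where t is the modified kernel
[trans_robin] ([robin_solutionE]). The system matrix is 1 - T with T the
restriction of t to S, so everything reduces to showing that T^n tends to 0:
this makes 1 - T injective, hence invertible, and the telescoping identity
(1 - T) (1 + T + ... + T^(n-1)) = 1 - T^n then gives the sum of the powers
([neumann_series]).

The modified kernel is complex, but its modulus is dominated by the transition
kernel p, because |beta| <= |alpha + beta| on the Robin part. Extended by 0 off
S, that modulus q is a nonnegative kernel below p, hence describes the walk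
with transition kernel p with some probability of being killed at each step.
The entries of T^n are bounded by the probability that this walk survives n
steps ([restr_mx_exp_le]). Survival probabilities decrease in n, and their
limit h satisfies h = q h. Such an h vanishes by the maximum principle
([subharmonic_eq0]): equality in h <= q h <= p h propagates a positive maximum
along the edges to the whole strongly connected graph, in particular to a vertex
where |beta| < |alpha + beta|, and there the row sum of q is less than 1. *)

(** * Walks with killing and the maximum principle *)

Section KilledWalk.
Variables (R : realType) (X : finType) (E : rel X) (p q : X -> X -> R) (x0 : X).
Hypothesis E_connected : strongly_connected E.
Hypothesis p_gt0 : forall x y, E x y -> 0 < p x y.
Hypothesis p_sum_le1 : forall x, \sum_y p x y <= 1.
Hypothesis q_ge0 : forall x y, 0 <= q x y.
Hypothesis q_le_p : forall x y, q x y <= p x y.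
Hypothesis q_leak : \sum_y q x0 y < 1.

(** At a point where h attains a positive maximum, h <= q h <= p h and row sums of
p at most 1 force every neighbour to attain it too. Connectedness carries the
maximum to x0, where the row sum of q is less than 1. *)
Lemma subharmonic_eq0 (h : X -> R) :
  (forall x, 0 <= h x) -> (forall x, h x <= \sum_y q x y * h y) ->
  forall x, h x = 0.
Proof.
move=> h_ge0 h_sub.
have p_ge0 x y : 0 <= p x y by exact: le_trans (q_le_p x y).
pose top := [arg max_(x > x0) h x]%O.
have h_le z : h z <= h top by rewrite /top; case: arg_maxP => // i _; exact.
suff h_top : h top <= 0.
  by move=> x; apply/le_anti; rewrite h_ge0 (le_trans (h_le x)).
rewrite leNgt; apply/negP => top_gt0.
have h_step x y : h x = h top -> E x y -> h y = h top.
  move=> hx Exy; apply/esym/eqP; rewrite -subr_eq0.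
  (* The p-average of the defects h top - h z is at most 0, while each defect is
     nonnegative; hence all those with p x z > 0 vanish. *)
  have gap_ge0 z : 0 <= p x z * (h top - h z).
    by rewrite mulr_ge0 ?p_ge0 ?subr_ge0.
  have gap_sum : \sum_z p x z * (h top - h z) == 0.
    rewrite eq_le sumr_ge0 1?andbT; last by move=> z _; exact: gap_ge0.
    under eq_bigr => z _ do rewrite mulrBr.
    rewrite sumrB -mulr_suml subr_le0.
    apply: (@le_trans _ _ (h top)); first by rewrite ler_piMl // ltW.
    rewrite -{1}hx; apply: le_trans (h_sub x) _.
    by apply: ler_sum => z _; rewrite ler_wpM2r.
  move: gap_sum; rewrite psumr_eq0; last by move=> z _; exact: gap_ge0.
  by move=> /allP/(_ y (mem_index_enum _)) /=; rewrite mulf_eq0 gt_eqF ?p_gt0.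
have h_x0 : h x0 = h top.
  have /connectP[s s_path ->] := E_connected top x0.
  elim: s {1 3 4}top (erefl (h top)) s_path => [|y s IHs] x hx //= /andP[Exy].
  by apply: IHs; exact: h_step Exy.
suff : h top < h top by rewrite ltxx.
rewrite -{1}h_x0; apply: le_lt_trans (h_sub x0) _.
apply: (@le_lt_trans _ _ ((\sum_y q x0 y) * h top)).
  by rewrite mulr_suml; apply: ler_sum => z _; rewrite ler_wpM2l.
by rewrite gtr_pMl.
Qed.

(** The probability that the walk with substochastic kernel q, started at x, has
not been killed during its first n steps. *)
Definition survival n : X -> R :=
  iter n (fun h x => \sum_y q x y * h y) (fun=> 1).

Lemma survivalS n x : survival n.+1 x = \sum_y q x y * survival n y.
Proof. by []. Qed.

Lemma survival_ge0 n x : 0 <= survival n x.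
Proof.
elim: n x => [|n IHn] x //.
by rewrite survivalS sumr_ge0 // => y _; rewrite mulr_ge0.
Qed.

Lemma survival_noninc n x : survival n.+1 x <= survival n x.
Proof.
elim: n x => [|n IHn] x.
  apply: le_trans (p_sum_le1 x); apply: ler_sum => y _.
  by rewrite mulr1.
by rewrite survivalS [leRHS]survivalS; apply: ler_sum => y _; rewrite ler_wpM2l.
Qed.

(** The survival probabilities decrease to a limit h with h = q h, to which the
maximum principle applies. *)
Lemma survival_cvg0 x : survival n x @[n --> \oo] --> 0.
Proof.
pose h y := inf (range (fun n => survival n y)).
have h_lim y : survival n y @[n --> \oo] --> h y.
  apply: nonincreasing_cvgn; last by exists 0 => _ [n _ <-]; exact: survival_ge0.
  by apply/nonincreasing_seqP => n; exact: survival_noninc.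
have h_harm y : h y = \sum_z q y z * h z.
  have h_shift : \sum_z q y z * survival n z @[n --> \oo] --> h y.
    by have := h_lim y; rewrite -cvg_shiftS.
  apply: cvg_unique h_shift _; first exact: norm_hausdorff.
  apply: cvg_big => [|z _]; first exact: add_continuous.
  exact: cvgMl_tmp.
rewrite -(@subharmonic_eq0 h _ _ x); first exact: h_lim.
  move=> y; rewrite -(cvg_lim _ (h_lim y)) //.
  apply: limr_ge; first by apply/cvg_ex; exists (h y).
  by near=> n; exact: survival_ge0.
by move=> y; rewrite -h_harm.
Unshelve. all: by end_near. Qed.

End KilledWalk.

(** * Neumann series of complex matrices *)

Section Neumann.
Variable R : realType.

(** The modulus of a complex number is itself an element of R[i], and so are the
radii of its balls; a radius e > 0 is real, equal to the image of its real part,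
which is how convergence in R passes to convergence in R[i]. *)
Lemma cvg0_dominated (z : nat -> R[i]) (b : nat -> R) :
  (forall k, `|z k| <= (b k)%:C) -> b @ \oo --> 0 -> z @ \oo --> 0.
Proof.
move=> z_le b_lim; apply/cvgr0Pnorm_lt => e e_gt0.
have e_re : (complex.Re e)%:C = e by rewrite RRe_real // gtr0_real.
have re_gt0 : 0 < complex.Re e by rewrite -ltcR e_re.
near=> k; rewrite -e_re; apply: le_lt_trans (z_le k) _.
rewrite ltcR; apply: le_lt_trans (ler_norm _) _.
by near: k; move/cvgr0Pnorm_lt: b_lim; apply.
Unshelve. all: by end_near. Qed.

Lemma cvg_mx_coord m n (A : nat -> 'M[R[i]]_(m, n)) (L : 'M[R[i]]_(m, n)) :
  (forall i j, A k i j @[k --> \oo] --> L i j) -> A @ \oo --> L.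
Proof.
move=> A_lim U [V V_nbhs VU].
have VA : \forall k \near \oo, forall i j, V i j (A k i j).
  by apply: filter_forall => i; apply: filter_forall => j; exact: A_lim (V_nbhs i j).
by apply: filterS VA => k; exact: VU.
Qed.

(** Convergence of the powers to 0 replaces the usual bound on an operator norm:
v M = v implies v = v M^k, which tends to 0, so 1 - M is injective on row vectors,
and the k-th partial sum is G - G M^k with G the inverse of 1 - M. *)
Lemma neumann_series n (M : 'M[R[i]]_n) :
  (forall i j, (M ^+ k) i j @[k --> \oo] --> 0) ->
  1%:M - M \in unitmx /\
  series (fun k => M ^+ k) @ \oo --> invmx (1%:M - M).
Proof.
move=> M_lim.
have M_unit : 1%:M - M \in unitmx.
  rewrite -row_free_unit -kermx_eq0; apply/rowV0P => v /sub_kermxP.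
  rewrite mulmxBr mulmx1 => /subr0_eq vM.
  have vMk k : v = v *m M ^+ k.
    elim: k => [|k IHk]; first by rewrite expr0 mulmx1.
    by rewrite exprS mulmxA -vM.
  apply/rowP => j; rewrite mxE.
  have v_cvg : v 0 j @[k --> \oo] --> \sum_i v 0 i * 0.
    rewrite (_ : (fun=> v 0 j) = fun k => \sum_i v 0 i * (M ^+ k) i j); last first.
      by apply/funext => k; rewrite {1}(vMk k) mxE.
    apply: cvg_big => [|i _]; first exact: add_continuous.
    exact: cvgMl_tmp.
  rewrite big1 in v_cvg => [|i _]; last by rewrite mulr0.
  apply: cvg_unique v_cvg; first exact: norm_hausdorff.
  exact: cvg_cst.
split=> //; apply: cvg_mx_coord => i j.
pose G := invmx (1%:M - M).
have seriesE k : series (fun k => M ^+ k) k = G - G *m M ^+ k.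
  have geom : (1%:M - M) *m series (fun k => M ^+ k) k = 1%:M - M ^+ k.
    rewrite seriesEord -[1%:M]/(1 : 'M[R[i]]_n) -opprB mulNmx.
    by rewrite -[_ *m _]/((M - 1) * _) -subrX1 opprB.
  by rewrite -[LHS](mulKmx M_unit) geom mulmxBr mulmx1.
have -> : G i j = G i j - \sum_l G i l * 0.
  by rewrite big1 ?subr0 // => l _; rewrite mulr0.
rewrite (_ : (fun k => _) = fun k => G i j - \sum_l G i l * (M ^+ k) l j); last first.
  by apply/funext => k; rewrite seriesE !mxE.
apply: cvgB; first exact: cvg_cst.
apply: cvg_big => [|l _]; first exact: add_continuous.
exact: cvgMl_tmp.
Qed.

End Neumann.

(** * Vectors and kernels restricted to a subset *)

Section Restriction.
Variables (R : realType) (X : finType).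
Implicit Types (S : {set X}) (t : X -> X -> R[i]).

(** An entry of the (n+1)-st power sums, over the first step inside S, the
products of a one-step entry and an n-step entry; this is the recursion that
defines the survival probabilities, which moreover sum over all of X. *)
Lemma restr_mx_exp_le S t (q : X -> X -> R) :
  (forall x y, 0 <= q x y) ->
  (forall x y, x \in S -> y \in S -> `|t x y| <= (q x y)%:C) ->
  forall n i j,
    `|(restr_mx S S t ^+ n) i j| <= (survival q n (enum_val i))%:C.
Proof.
move=> q_ge0 t_le n; elim: n => [|n IHn] i j.
  rewrite expr0 mxE -[survival _ _ _]/1 rmorph1.
  by case: (i == j); rewrite ?normr1 ?normr0 ?ler01.
rewrite exprS mxE survivalS rmorph_sum /=.
apply: le_trans (ler_norm_sum _ _ _) _.
apply: (@le_trans _ _ (\sum_(y in S) (q (enum_val i) y * survival q n y)%:C)).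
  rewrite [leRHS]big_enum_val; apply: ler_sum => k _.
  rewrite mxE normrM rmorphM ler_pM // t_le //; exact: enum_valP.
rewrite [leRHS](bigID (mem S)) /= lerDl sumr_ge0 // => y _.
by rewrite lecR mulr_ge0 // survival_ge0.
Qed.

Lemma restr_mx_mulE S T t (u : X -> R[i]) (i : 'I_#|S|) :
  (restr_mx S T t *m restr T u) i 0 = \sum_(y in T) t (enum_val i) y * u y.
Proof. by rewrite mxE [RHS]big_enum_val; apply: eq_bigr => k _; rewrite !mxE. Qed.

(** Together with [restr_inj], this passes between column vectors indexed by S and
functions on X with prescribed values off S. *)
Lemma restr_surj S (w : 'cV[R[i]]_#|S|) (c : X -> R[i]) :
  exists2 u : {ffun X -> R[i]},
    restr S u = w & forall x, x \notin S -> u x = c x.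
Proof.
exists [ffun x => if [pick i | enum_val i == x] is Some i then w i 0 else c x].
  apply/colP => i; rewrite mxE ffunE.
  case: pickP => [k /eqP/enum_val_inj -> // | /(_ i)].
  by rewrite eqxx.
move=> x xS; rewrite ffunE; case: pickP => [k /eqP kx|//].
by rewrite -kx enum_valP in xS.
Qed.

Lemma restr_inj S (u v : X -> R[i]) :
  restr S u = restr S v -> forall x, x \in S -> u x = v x.
Proof.
move=> uv x xS; have := congr1 (fun w : 'cV__ => w (enum_rank_in xS x) 0) uv.
by rewrite !mxE enum_rankK_in.
Qed.

End Restriction.

(** * The network and its Robin boundary problem *)

Section Network.
Variables (R : realType) (X : finType) (E : rel X) (a : X -> X -> R).
Hypothesis card_X : (2 <= #|X|)%N.
Hypothesis E_connected : strongly_connected E.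
Hypothesis a_weights : weights_on E a.

Lemma weight_ge0 x y : 0 <= a x y.
Proof.
have [a_pos a_zero] := a_weights x y.
by case: (boolP (E x y)) => [/a_pos/ltW | /a_zero ->].
Qed.

(** With at least two vertices, a path from x to another vertex starts with an edge
that leaves x. *)
Lemma mass_gt0 x : 0 < mass a x.
Proof.
have [z zx] : exists z, z != x.
  have /card_gt1P[y [z [_ _ yz]]] := card_X.
  have [yx|] := eqVneq y x; last by exists y.
  by exists z; rewrite -yx eq_sym.
have /connectP[[|y s] /= s_path s_last] := E_connected x z.
  by rewrite s_last eqxx in zx.
have /andP[Exy _] := s_path.
rewrite /mass (bigD1 y) //= ltr_wpDr ?(a_weights x y).1 //.
by apply: sumr_ge0 => i _; exact: weight_ge0.
Qed.

Lemma trans_ge0 x y : 0 <= trans a x y.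
Proof. by rewrite divr_ge0 ?weight_ge0 // ltW ?mass_gt0. Qed.

Lemma trans_gt0 x y : E x y -> 0 < trans a x y.
Proof. by move=> Exy; rewrite divr_gt0 ?mass_gt0 ?(a_weights x y).1. Qed.

Lemma trans_sum x : \sum_y trans a x y = 1.
Proof. by rewrite -mulr_suml divff // gt_eqF ?mass_gt0. Qed.

Variables (D : {set X}) (alpha beta f g : X -> R[i]).
Local Notation A := (robin_part D beta).
Local Notation B := (dirichlet_part D beta).
Local Notation S := (robin_interior D beta).
Local Notation t := (trans_robin a D alpha beta).
Local Notation ft := (source_robin D alpha beta f g).

Lemma in_robin_part x : (x \in A) = (x \in D) && (beta x != 0).
Proof. by rewrite !inE; case: (x \in D); rewrite ?andbF ?andbT. Qed.

Lemma robin_interiorE : S = ~: B.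
Proof. by apply/setP => x; rewrite !inE; case: (x \in D); case: eqP. Qed.

Hypothesis alpha_neq0 : forall x, x \in B -> alpha x != 0.
Hypothesis dominated : forall x, x \in A -> `|beta x| <= `|alpha x + beta x|.

Lemma robin_sum_neq0 x : x \in A -> alpha x + beta x != 0.
Proof.
move=> xA; rewrite -normr_gt0; apply: lt_le_trans (dominated xA).
by rewrite normr_gt0; move: xA; rewrite in_robin_part => /andP[].
Qed.

(** Each of the three kinds of vertices is treated on its own: an interior equation is
Delta u = f with the sign changed, the condition at a Robin vertex is divided by
alpha + beta, and at a Dirichlet vertex the condition is alpha u = g. In the
equations indexed by S, the part of the sum over B is then known and moves to the
right-hand side. *)
Lemma robin_solutionE (u : X -> R[i]) :
  robin_solution a D alpha beta f g u <->
  (forall x, x \in B -> u x = g x / alpha x) /\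
  (1%:M - trans_robin_mx a D alpha beta) *m restr S u =
    - (restr S ft - trans_robin_bd_mx a D alpha beta
                      *m restr B (fun x => g x / alpha x)).
Proof.
have coordE : (forall x, x \in B -> u x = g x / alpha x) ->
    ((1%:M - trans_robin_mx a D alpha beta) *m restr S u =
      - (restr S ft - trans_robin_bd_mx a D alpha beta
                        *m restr B (fun x => g x / alpha x))
     <-> forall x, x \in S -> u x - \sum_y t x y * u y = - ft x).
  move=> uB.
  have splitE x : \sum_y t x y * u y =
      \sum_(y in S) t x y * u y + \sum_(y in B) t x y * (g y / alpha y).
    rewrite (bigID (mem S)) /=; congr (_ + _).
    rewrite (eq_bigl (mem B)); last by move=> y; rewrite robin_interiorE inE negbK.
    by apply: eq_bigr => y yB; rewrite uB.
  have rowE i : ((1%:M - trans_robin_mx a D alpha beta) *m restr S u) i 0 =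
      u (enum_val i) - \sum_(y in S) t (enum_val i) y * u y.
    by rewrite mulmxBl mul1mx mxE [X in _ + X]mxE restr_mx_mulE mxE.
  have rhsE i : (- (restr S ft - trans_robin_bd_mx a D alpha beta
                      *m restr B (fun x => g x / alpha x))) i 0 =
      - ft (enum_val i) + \sum_(y in B) t (enum_val i) y * (g y / alpha y).
    by rewrite opprB mxE restr_mx_mulE [X in _ + X]mxE mxE addrC.
  split=> [uS x xS | uS].
    have := congr1 (fun w : 'cV__ => w (enum_rank_in xS x) 0) uS.
    rewrite rowE rhsE enum_rankK_in // splitE opprD addrA => ->.
    by rewrite addrK.
  apply/colP => i; rewrite rowE rhsE -uS ?enum_valP // splitE opprD addrA.
  by rewrite subrK.
have innerE x : x \notin D ->
    (u x - \sum_y t x y * u y = - ft x <-> laplacian a u x = f x).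
  move=> xD; rewrite /laplacian /transop /trans_robin /source_robin (negbTE xD).
  by rewrite -opprB; split=> [/oppr_inj | ->].
have robinE x : x \in A ->
    (u x - \sum_y t x y * u y = - ft x <->
     alpha x * u x + beta x * normal_deriv a u x = g x).
  move=> xA; have sum_neq0 := robin_sum_neq0 xA.
  have xD : x \in D by move: xA; rewrite in_robin_part => /andP[].
  rewrite /normal_deriv /laplacian /transop /trans_robin /source_robin xD.
  set Pu := \sum_y (trans a x y)%:C * u y.
  have -> : \sum_y beta x / (alpha x + beta x) * (trans a x y)%:C * u y =
      beta x / (alpha x + beta x) * Pu.
    by rewrite mulr_sumr; apply: eq_bigr => y _; rewrite mulrA.
  have -> : u x - beta x / (alpha x + beta x) * Pu =
      (alpha x + beta x)^-1 * (alpha x * u x + beta x * - (Pu - u x)).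
    by field.
  rewrite mulN1r !mulNr opprK; split=> [/(mulfI (invr_neq0 sum_neq0)) // | -> //].
have dirichletE x : x \in B ->
    (u x = g x / alpha x <->
     alpha x * u x + beta x * normal_deriv a u x = g x).
  move=> xB; have a_neq0 := alpha_neq0 xB.
  move: xB; rewrite inE => /andP[_ /eqP ->]; rewrite mul0r addr0.
  by split=> [-> | <-]; rewrite mulrC ?divfK // mulKf.
split=> [[u_in u_bd] | [uB /(coordE uB) uS]].
  have uB x : x \in B -> u x = g x / alpha x.
    by move=> xB; apply/dirichletE => //; apply: u_bd; move: xB; rewrite inE => /andP[].
  split=> //; apply/(coordE uB) => x; rewrite inE => /orP[xD | xA].
    by apply/innerE; [rewrite inE in xD | exact: u_in].
  by apply/robinE => //; apply: u_bd; move: xA; rewrite in_robin_part => /andP[].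
split=> x xD.
  by apply/innerE; [rewrite inE in xD | apply: uS; rewrite inE xD].
have [beta0 | beta_neq0] := eqVneq (beta x) 0.
  have xB : x \in B by rewrite inE xD beta0 eqxx.
  by apply/dirichletE => //; exact: uB.
have xA : x \in A by rewrite in_robin_part xD.
by apply/robinE => //; apply: uS; rewrite inE xA orbT.
Qed.

Hypothesis strictly_dominated :
  exists2 x, x \in A & `|beta x| < `|alpha x + beta x|.

(** The killed walk is the one with kernel |t| on S and 0 elsewhere: it dies on
leaving S, and also at a Robin vertex with probability
1 - |beta| / |alpha + beta|, which is positive at some such vertex. *)
Lemma trans_robin_exp_cvg0 i j :
  (trans_robin_mx a D alpha beta ^+ n) i j @[n --> \oo] --> (0 : R[i]).
Proof.
pose q x y := if (x \in S) && (y \in S) then complex.Re `|t x y| else 0.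
have normE (z : R[i]) : (complex.Re `|z|)%:C = `|z|.
  by rewrite RRe_real ?normr_real.
have transC_ge0 x y : 0 <= (trans a x y)%:C :> R[i] by rewrite lecR trans_ge0.
have t_A x y : x \in A -> `|t x y| =
    `|beta x| / `|alpha x + beta x| * (trans a x y)%:C.
  rewrite in_robin_part /trans_robin => /andP[-> _].
  by rewrite normrM normf_div [X in _ * X]ger0_norm.
have t_le x y : x \in S -> `|t x y| <= (trans a x y)%:C.
  rewrite inE => /orP[xD | xA].
    by rewrite /trans_robin; rewrite inE in xD; rewrite (negbTE xD) ger0_norm.
  rewrite t_A // ler_piMl // ler_pdivrMr ?mul1r ?dominated //.
  by rewrite normr_gt0 robin_sum_neq0.
have q_ge0 x y : 0 <= q x y.
  by rewrite /q; case: ifP => // _; rewrite -lecR normE normr_ge0.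
have q_le x y : q x y <= trans a x y.
  rewrite /q; case: ifP => [/andP[xS _]|_]; last exact: trans_ge0.
  by rewrite -lecR normE t_le.
have [x0 x0A x0_lt] := strictly_dominated.
have q_leak : \sum_y q x0 y < 1.
  pose r := complex.Re (`|beta x0| / `|alpha x0 + beta x0|).
  have rE : r%:C = `|beta x0| / `|alpha x0 + beta x0|.
    by rewrite /r -normf_div normE.
  have sum_gt0 : 0 < `|alpha x0 + beta x0| by rewrite normr_gt0 robin_sum_neq0.
  have r_lt1 : r < 1 by rewrite -ltcR rE ltr_pdivrMr ?mul1r.
  apply: le_lt_trans r_lt1; rewrite -[leRHS]mulr1 -(trans_sum x0) mulr_sumr.
  apply: ler_sum => y _; rewrite -lecR rmorphM /= rE -t_A // /q.
  by case: ifP => _; rewrite ?normE ?normr_ge0.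
have p_le1 x : \sum_y trans a x y <= 1 by rewrite trans_sum.
apply: (cvg0_dominated (b := fun n => survival q n (enum_val i))).
  move=> n; apply: restr_mx_exp_le => // x y xS yS.
  by rewrite /q xS yS normE.
exact: (survival_cvg0 E_connected trans_gt0 p_le1 q_ge0 q_le q_leak).
Qed.

End Network.

Theorem mainTheorem4 (R : realType) (X : finType) (E : rel X)
  (a : X -> X -> R) (D : {set X}) (alpha beta f g : X -> R[i])
  (card_X : (2 <= #|X|)%N)
  (E_loopless : irreflexive E)
  (E_connected : strongly_connected E)
  (a_weights : weights_on E a)
  (D_nonempty : exists x, x \in D)
  (alpha_neq0 : forall x, x \in dirichlet_part D beta -> alpha x != 0)
  (dominated : forall x, x \in robin_part D beta ->
     `|beta x| <= `|alpha x + beta x|)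
  (strictly_dominated : exists2 x, x \in robin_part D beta &
     `|beta x| < `|alpha x + beta x|) :
  let B := dirichlet_part D beta in
  let S := robin_interior D beta in
  let Pt := trans_robin_mx a D alpha beta in
  let Gt := green_robin_mx a D alpha beta in
  [/\ 1%:M - Pt \in unitmx,
      series (fun n : nat => Pt ^+ n) @ \oo --> Gt
    & exists u : {ffun X -> R[i]},
      [/\ robin_solution a D alpha beta f g u,
          forall v : {ffun X -> R[i]},
            robin_solution a D alpha beta f g v -> v = u,
          forall x, x \in B -> u x = g x / alpha x
        & restr S u =
            - Gt *m (restr S (source_robin D alpha beta f g)
                     - trans_robin_bd_mx a D alpha beta
                         *m restr B (fun x => g x / alpha x))]].
Proof.
move=> B S Pt Gt.
have [Pt_unit Gt_lim] : 1%:M - Pt \in unitmx /\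
    series (fun n : nat => Pt ^+ n) @ \oo --> Gt.
  by apply: neumann_series => i j; exact: (trans_robin_exp_cvg0 card_X E_connected).
split=> //.
set rhs := restr S (source_robin D alpha beta f g) - _.
have solE := robin_solutionE a f g alpha_neq0 dominated.
have [u uS uB] := restr_surj (- Gt *m rhs) (fun x => g x / alpha x).
have notin_S x : (x \notin S) = (x \in B).
  by rewrite /S robin_interiorE inE negbK.
have {}uB x : x \in B -> u x = g x / alpha x by rewrite -notin_S; exact: uB.
exists u; split=> //.
  by apply/solE; split=> //; rewrite uS mulNmx mulmxN mulKVmx.
move=> v /solE[vB vS]; apply/ffunP => x.
have [xS | ] := boolP (x \in S); last by rewrite notin_S => xB; rewrite uB ?vB.
apply: restr_inj xS.
by rewrite uS -(mulKmx Pt_unit (restr S v)) vS mulmxN mulNmx.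
Qed.
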